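(* Let $n\ge2$ and let $K$ be an algebraically closed field of characteristic $p>0$ (so $K\supset\mathbb{F}_q$). Let $V(\Delta_n):=\{\underline a\in K^n : \Delta_n(\underline a)=0\}$. The map $$\varphi:K^n\to K^n,\qquad \underline a=(a_1,\dots,a_n)\mapsto\big(\Delta_{n-1}(\underline{\hat a_i})\big)_{1\le i\le n}$$ induces a surjective map from $K^n\setminus V(\Delta_n)$ onto itself. Moreover, for $\underline a,\underline{a'}\in K^n\setminus V(\Delta_n)$, one has $\varphi(\underline a)=\varphi(\underline{a'})$ if and only if $\underline{a'}=\lambda\underline a$ for some $\lambda\in K$ with $\lambda^{1+q+\cdots+q^{n-2}}=1$.
   Context: $q=p^s$ is a power of $p$. For $\underline a=(a_1,\dots,a_n)\in K^n$, $\Delta_n(\underline a):=\det\big(a_j^{q^{i-1}}\big)_{1\le i,j\le n}$ is the Moore determinant, and $\underline{\hat a_i}:=(a_1,\dots,a_{i-1},a_{i+1},\dots,a_n)$. *)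

(* Defs.v *)
From HB Require Import structures.
From mathcomp Require Import all_boot all_order all_algebra.

Set Implicit Arguments.
Unset Strict Implicit.
Unset Printing Implicit Defensive.

Import GRing.Theory.
Local Open Scope ring_scope.

(* Rows are indexed from 0, so the exponent q^(i-1) of row i (counted from 1)
   is written q ^ i. *)
Definition moore_det (K : fieldType) (q n : nat) (a : 'rV[K]_n) : K :=
  \det (\matrix_(i < n, j < n) a 0 j ^+ (q ^ i)%N).

(* V(Delta_n), as a subset of K^n. *)
Definition moore_zeros (K : fieldType) (q n : nat) : {pred 'rV[K]_n} :=
  [pred a | moore_det q a == 0].
Arguments moore_zeros : clear implicits.

(* col' i a : 'rV_n.-1 is the vector a with its i-th entry removed. *)
Definition moore_phi (K : fieldType) (q n : nat) (a : 'rV[K]_n) : 'rV[K]_n :=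
  \row_(i < n) moore_det q (col' i a).

(* Main.v *)
(** For [a, b] in [K^n] put [<a, b> := \sum_j (-1)^j a_j b_j], and write [F] for
    the coordinatewise [q]-th power, so that [<F a, F b> = <a, b>^q].  Expanding
    Moore determinants along their first row gives [<F^i a, phi a> = 0] for
    [i < n - 1] and [<a, F (phi a)> = Delta a].  Let [a] be outside [V(Delta_n)]
    and [b := phi a].  The Gram matrix of [F b, ..., F^n b] and
    [a, F a, ..., F^(n-1) a] is triangular with diagonal entries powers of
    [Delta a], so [b] is outside [V(Delta_n)] too.  Moreover [F^(n-1) a] is
    orthogonal to [F b, ..., F^(n-1) b], and the vectors with this property form
    the line spanned by [phi (F b)]; hence [F^(n-1) a] and [F (phi (phi a))] are
    proportional.  It follows that [phi a] determines [a] up to a scalar, and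
    that any [c] outside [V(Delta_n)] is proportional to [phi a] as soon as
    [F^(n-2) a = phi c].  Scalars are adjusted by the homogeneity of [phi]. *)

From HB Require Import structures.
Require Import Defs.
From mathcomp Require Import all_boot all_order all_algebra.

Set Implicit Arguments.
Unset Strict Implicit.
Unset Printing Implicit Defensive.

Import GRing.Theory.
Local Open Scope ring_scope.

Section PcharPower.

Variables (R : comNzSemiRingType) (Q : nat).

Definition pchar_power of [pchar R].-nat Q := fun x : R => x ^+ Q.

Hypothesis pcharQ : [pchar R].-nat Q.

Lemma pchar_power_is_monoid_morphism : monoid_morphism (pchar_power pcharQ).
Proof. by split=> [|x y]; rewrite /pchar_power ?expr1n ?exprMn. Qed.

Lemma pchar_power_is_nmod_morphism : nmod_morphism (pchar_power pcharQ).
Proof.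
split=> [|x y]; last exact: exprDn_pchar.
by rewrite /pchar_power expr0n gtn_eqF //; case/andP: pcharQ.
Qed.

HB.instance Definition _ :=
  GRing.isNmodMorphism.Build R R (pchar_power pcharQ)
    pchar_power_is_nmod_morphism.
HB.instance Definition _ :=
  GRing.isMonoidMorphism.Build R R (pchar_power pcharQ)
    pchar_power_is_monoid_morphism.

End PcharPower.

Lemma closed_nth_root (K : closedFieldType) (N : nat) (c : K) :
  (0 < N)%N -> exists x : K, x ^+ N = c.
Proof.
move=> N_gt0.
have /closed_rootP[x] : size ('X^N - c%:P : {poly K}) != 1%N.
  by rewrite size_XnsubC //; case: N N_gt0.
by rewrite /root !hornerE subr_eq0 => /eqP <-; exists x.
Qed.

Lemma map_pchar_power_surj (K : closedFieldType) (m n Q : nat)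
    (pcharQ : [pchar K].-nat Q) (B : 'M[K]_(m, n)) :
  exists A, map_mx (pchar_power pcharQ) A = B.
Proof.
have Q_gt0 : (0 < Q)%N by case/andP: pcharQ.
have [f fE] := fin_all_exists (fun ij => closed_nth_root (B ij.1 ij.2) Q_gt0).
exists (\matrix_(i, j) f (i, j)); apply/matrixP=> i j; rewrite !mxE.
exact: (fE (i, j)).
Qed.

Lemma eqmx_rV (K : fieldType) (n : nat) (u v : 'rV[K]_n) :
  u != 0 -> (u <= v)%MS -> (u :=: v)%MS.
Proof.
move=> u_neq0 /sub_rVP[c uE]; move: u_neq0; rewrite uE scaler_eq0 negb_or.
by case/andP=> c_neq0 _; apply: eqmx_scale.
Qed.

Section AlternatingForm.

Variable R : comNzRingType.

(* The entries of phi are unsigned minors, so the signs of the Laplace expansion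
   are carried by the form instead. *)
Definition altsign_mx n : 'M[R]_n := diag_mx (\row_(j < n) (-1) ^+ j).

Definition altform k l n (A : 'M[R]_(k, n)) (B : 'M[R]_(l, n)) : 'M[R]_(k, l) :=
  A *m altsign_mx n *m B^T.

Definition altcross n (B : 'M[R]_(n, n.+1)) : 'rV[R]_n.+1 :=
  \row_j \det (col' j B).

Lemma altsign_mx_sqr n : altsign_mx n *m altsign_mx n = 1%:M.
Proof.
rewrite mulmx_diag -diag_const_mx; congr diag_mx.
by apply/rowP=> j; rewrite !mxE -expr2 sqrr_sign.
Qed.

Lemma trmx_altform k l n (A : 'M_(k, n)) (B : 'M_(l, n)) :
  (altform A B)^T = altform B A.
Proof. by rewrite !trmx_mul trmxK tr_diag_mx mulmxA. Qed.

Lemma altformC n (x y : 'rV_n) : altform x y = altform y x.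
Proof. by rewrite -trmx_altform [LHS]mx11_scalar [RHS]mx11_scalar mxE. Qed.

Lemma row_altform k l n (A : 'M_(k, n)) (B : 'M_(l, n)) i :
  row i (altform A B) = altform (row i A) B.
Proof. by rewrite !row_mul. Qed.

Lemma altformE k l n (A : 'M_(k, n)) (B : 'M_(l, n)) i j :
  altform A B i j = altform (row i A) (row j B) 0 0.
Proof.
rewrite -row_altform -[altform A (row j B)]trmx_altform -row_altform.
by rewrite -[altform A B]trmx_altform [LHS]mxE [RHS]mxE [RHS]mxE [RHS]mxE.
Qed.

Lemma altformZr k l n c (A : 'M_(k, n)) (B : 'M_(l, n)) :
  altform A (c *: B) = c *: altform A B.
Proof. by rewrite /altform linearZ -scalemxAr. Qed.

Lemma altform_col_mx k1 k2 l n (A1 : 'M_(k1, n)) (A2 : 'M_(k2, n))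
    (B : 'M_(l, n)) :
  altform (col_mx A1 A2) B = col_mx (altform A1 B) (altform A2 B).
Proof. by rewrite /altform !mul_col_mx. Qed.

Lemma altform_altcross n (x : 'rV_n.+1) (B : 'M_(n, n.+1)) :
  altform x (altcross B) = (\det (col_mx x B : 'M_n.+1))%:M.
Proof.
rewrite [LHS]mx11_scalar (expand_det_row (col_mx x B : 'M_n.+1) 0).
congr _%:M; rewrite mxE; apply: eq_bigr => j _.
rewrite mul_mx_diag !mxE split1 unlift_none -mulrA; congr (_ * (_ * \det _)).
by apply/matrixP=> i k; rewrite !mxE split1 liftK.
Qed.

Lemma altform_altcross_eq0 n (B : 'M_(n, n.+1)) : altform B (altcross B) = 0.
Proof.
apply/row_matrixP=> i; rewrite row_altform row0 altform_altcross.
rewrite (determinant_alternate (neq_lift 0 i)) ?raddf0 // => j.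
by rewrite !mxE !split1 unlift_none liftK /= mxE.
Qed.

End AlternatingForm.

Lemma map_altform (R S : comNzRingType) (f : {rmorphism R -> S}) k l n
    (A : 'M_(k, n)) (B : 'M_(l, n)) :
  map_mx f (altform A B) = altform (map_mx f A) (map_mx f B).
Proof.
rewrite !map_mxM -map_trmx map_diag_mx; congr (_ *m diag_mx _ *m _).
by apply/rowP=> j; rewrite !mxE rmorph_sign.
Qed.

Lemma sub_altcross (K : fieldType) n (x y : 'rV[K]_n.+1) (B : 'M_(n, n.+1)) :
    \det (col_mx y B : 'M_n.+1) != 0 -> altform B x = 0 ->
  (x <= altcross B)%MS.
Proof.
set N : 'M_n.+1 := col_mx y B; move=> detN_neq0 Bx0.
have unitN : N \in unitmx by rewrite unitmxE unitfE.
have [unitD _] := mulmx1_unit (altsign_mx_sqr K n.+1).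
have altform_inj : injective (altform N : 'rV_n.+1 -> _).
  apply: inj_comp trmx_inj; apply: can_inj (mulKmx _).
  by rewrite unitmx_mul unitN.
apply/sub_rVP; exists (altform y x 0 0 / \det N); apply: altform_inj.
have altformN (z : 'rV_n.+1) : altform N z = col_mx (altform y z) (altform B z).
  exact: (altform_col_mx y B z).
rewrite !altformN !altformZr Bx0 altform_altcross_eq0 altform_altcross.
by rewrite scaler0 scale_scalar_mx divfK // -mx11_scalar.
Qed.

Lemma moore_detZ (K : fieldType) (q n : nat) (c : K) (a : 'rV[K]_n) :
  moore_det q (c *: a) = c ^+ (\sum_(i < n) q ^ i)%N * moore_det q a.
Proof.
rewrite -prodrXr; set d := \row_(i < n) c ^+ (q ^ i)%N.
have <- : \det (diag_mx d) = \prod_(i < n) c ^+ (q ^ i)%N.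
  by rewrite det_diag; apply: eq_bigr => i _; rewrite mxE.
rewrite -det_mulmx mul_diag_mx; congr (\det _); apply/matrixP=> i j.
by rewrite !mxE exprMn.
Qed.

Lemma moore_phiZ (K : fieldType) (q n : nat) (c : K) (a : 'rV[K]_n) :
  moore_phi q (c *: a) = c ^+ (\sum_(i < n.-1) q ^ i)%N *: moore_phi q a.
Proof.
apply/rowP=> j; rewrite !mxE -moore_detZ; congr (moore_det _ _).
by apply/rowP=> k; rewrite !mxE.
Qed.

Section Moore.

Variables (K : fieldType) (q : nat).
Hypothesis pcharq : [pchar K].-nat q.

Lemma pchar_natX k : [pchar K].-nat (q ^ k)%N.
Proof. by rewrite pnatX pcharq. Qed.

Local Notation Frob k := (map_mx (pchar_power (pchar_natX k))).

Definition moore_mx k n (a : 'rV[K]_n) : 'M[K]_(k, n) :=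
  \matrix_(i, j) a 0 j ^+ (q ^ i)%N.

Lemma Frob_add n k l (a : 'rV[K]_n) : Frob k (Frob l a) = Frob (k + l) a.
Proof. by apply/rowP=> j; rewrite !mxE /pchar_power -exprM -expnD addnC. Qed.

Lemma row_moore_mx k n (a : 'rV[K]_n) i : row i (moore_mx k a) = Frob i a.
Proof. by apply/rowP=> j; rewrite !mxE. Qed.

Lemma moore_mx_recl k n (a : 'rV[K]_n) :
  moore_mx k.+1 a = col_mx a (moore_mx k (Frob 1 a)).
Proof.
apply/matrixP=> i j; rewrite [RHS]mxE split1.
case: unliftP => [h|] -> /=; rewrite !mxE ?expr1 //.
by rewrite /pchar_power -exprM -expnD.
Qed.

Lemma map_moore_mx k l n (a : 'rV[K]_n) :
  Frob k (moore_mx l a) = moore_mx l (Frob k a).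
Proof. by apply/matrixP=> i j; rewrite !mxE exprAC. Qed.

Lemma moore_det_Frob k n (a : 'rV[K]_n) :
  moore_det q (Frob k a) = moore_det q a ^+ (q ^ k).
Proof.
have := det_map_mx (pchar_power (pchar_natX k)) (moore_mx n a).
by rewrite map_moore_mx.
Qed.

Lemma mem_moore_zeros_Frob k n (a : 'rV[K]_n) :
  (Frob k a \in moore_zeros K q n) = (a \in moore_zeros K q n).
Proof.
rewrite !inE moore_det_Frob.
exact: (fmorph_eq0 (pchar_power (pchar_natX k))).
Qed.

Lemma moore_phi_Frob k n (a : 'rV[K]_n) :
  moore_phi q (Frob k a) = Frob k (moore_phi q a).
Proof.
by apply/rowP=> j; rewrite !mxE /pchar_power -moore_det_Frob map_col'.
Qed.

Lemma moore_phi_altcross n (a : 'rV[K]_n.+1) :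
  moore_phi q a = altcross (moore_mx n a).
Proof.
apply/rowP=> j; rewrite !mxE; congr (\det _).
by apply/matrixP=> i k; rewrite !mxE.
Qed.

Lemma altform_Frob_moore_phi_eq0 n (a : 'rV[K]_n.+1) i k :
  (k <= i < k + n)%N -> altform (Frob i a) (Frob k (moore_phi q a)) = 0.
Proof.
case/andP=> le_ki lt_i; rewrite -(subnKC le_ki) -Frob_add -map_altform.
have lt_in : (i - k < n)%N by rewrite ltn_subLR.
rewrite -(row_moore_mx a (Ordinal lt_in)) moore_phi_altcross.
by rewrite -row_altform altform_altcross_eq0 row0 map_mx0.
Qed.

Lemma altform_Frob_moore_phi n (a : 'rV[K]_n.+1) k :
  altform (Frob k a) (Frob (k + 1) (moore_phi q a))
  = (moore_det q a ^+ (q ^ k))%:M.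
Proof.
rewrite -Frob_add -map_altform -moore_phi_Frob moore_phi_altcross.
by rewrite altform_altcross -moore_mx_recl map_scalar_mx.
Qed.

Lemma notin_moore_zeros_neq0 n (a : 'rV[K]_n.+1) :
  a \notin moore_zeros K q n.+1 -> a != 0.
Proof.
apply: contraNneq => ->; rewrite inE /moore_det (expand_det_row _ 0).
by rewrite big1 // => j _; rewrite !mxE expr1 mul0r.
Qed.

Lemma moore_phi_notin_zeros n (a : 'rV[K]_n.+1) :
    a \notin moore_zeros K q n.+1 ->
  moore_phi q a \notin moore_zeros K q n.+1.
Proof.
rewrite !inE => det_a_neq0; set b := moore_phi q a.
pose gram := altform (moore_mx n.+1 (Frob 1 b)) (moore_mx n.+1 a).
have gramE k i : gram k i = altform (Frob i a) (Frob (k + 1) b) 0 0.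
  by rewrite /gram altformE !row_moore_mx Frob_add altformC.
have gram_trig : is_trig_mx gram.
  apply/is_trig_mxP=> k i lt_ki.
  rewrite gramE altform_Frob_moore_phi_eq0 ?mxE // addn1 lt_ki addSn ltnS.
  by rewrite (leq_trans (leq_ord i)) ?leq_addl.
have : \det gram != 0.
  rewrite det_trig //; apply/prodf_neq0=> i _.
  by rewrite gramE altform_Frob_moore_phi mxE expf_neq0.
rewrite !det_mulmx !mulf_eq0 !negb_or => /andP[/andP[+ _] _].
by rewrite [_ == 0](mem_moore_zeros_Frob 1 b) inE.
Qed.

Lemma eqmx_moore_phi_twice n (a : 'rV[K]_n.+1) :
    a \notin moore_zeros K q n.+1 ->
  (Frob n a :=: Frob 1 (moore_phi q (moore_phi q a)))%MS.
Proof.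
move=> a_nz; have b_nz := moore_phi_notin_zeros a_nz.
set b := moore_phi q a in b_nz *.
apply: eqmx_rV; first by rewrite map_mx_eq0 notin_moore_zeros_neq0.
have orthogonal : altform (moore_mx n (Frob 1 b)) (Frob n a) = 0.
  apply/row_matrixP=> i; rewrite row_altform row0 row_moore_mx Frob_add.
  rewrite altformC altform_Frob_moore_phi_eq0 // addn1 ltn_ord.
  by rewrite addSn ltnS leq_addl.
rewrite -moore_phi_Frob moore_phi_altcross (sub_altcross (y := b)) //.
by rewrite -moore_mx_recl.
Qed.

Lemma eq_moore_phi n (a a' : 'rV[K]_n.+1) :
    a \notin moore_zeros K q n.+1 -> a' \notin moore_zeros K q n.+1 ->
  moore_phi q a = moore_phi q a' <->
  exists2 c : K, c ^+ (\sum_(i < n) q ^ i)%N = 1 & a' = c *: a.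
Proof.
move=> a_nz a'_nz; split=> [eq_phi|[c c1 ->]]; last first.
  by rewrite moore_phiZ c1 scale1r.
have /sub_rVP[c a'E] : (a' <= a)%MS.
  rewrite -(map_submx (pchar_power (pchar_natX n))).
  by rewrite (eqmx_moore_phi_twice a_nz) (eqmx_moore_phi_twice a'_nz) eq_phi.
exists c => //; apply/eqP; rewrite -subr_eq0.
have phi_neq0 := notin_moore_zeros_neq0 (moore_phi_notin_zeros a_nz).
rewrite -[_ == 0]orbF -(negPf phi_neq0) -scaler_eq0 scalerBl scale1r.
by rewrite -moore_phiZ -a'E eq_phi subrr.
Qed.

End Moore.

Lemma moore_phi_surj (K : closedFieldType) (q n : nat) (b : 'rV[K]_n.+2) :
    [pchar K].-nat q -> b \notin moore_zeros K q n.+2 ->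
  exists2 a, a \notin moore_zeros K q n.+2 & moore_phi q a = b.
Proof.
move=> pcharq b_nz.
have [a aE] := map_pchar_power_surj (pchar_natX pcharq n) (moore_phi q b).
have a_nz : a \notin moore_zeros K q n.+2.
  by rewrite -(mem_moore_zeros_Frob pcharq n) aE moore_phi_notin_zeros.
have /sub_rVP[c bE] : (b <= moore_phi q a)%MS.
  rewrite -(map_submx (pchar_power (pchar_natX pcharq n.+1))).
  by rewrite (eqmx_moore_phi_twice _ b_nz) -aE moore_phi_Frob Frob_add.
have sum_gt0 : (0 < \sum_(i < n.+1) q ^ i)%N by rewrite big_ord_recl expn0.
have [c' c'E] := closed_nth_root c sum_gt0.
have phiE : moore_phi q (c' *: a) = b by rewrite moore_phiZ c'E.
exists (c' *: a) => //; rewrite inE moore_detZ mulf_neq0 // expf_neq0 //.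
have := notin_moore_zeros_neq0 b_nz; apply: contraNneq => c'0.
by rewrite bE -c'E c'0 expr0n gtn_eqF // scale0r.
Qed.

Theorem proposition5p1 (K : closedFieldType) (p s q n : nat)
    (charK : p \in [pchar K]) (s_gt0 : (0 < s)%N) (qE : q = (p ^ s)%N)
    (n_ge2 : (2 <= n)%N) :
  [/\ forall a : 'rV[K]_n,
        a \notin moore_zeros K q n -> moore_phi q a \notin moore_zeros K q n,
      forall b : 'rV[K]_n,
        b \notin moore_zeros K q n ->
        exists2 a : 'rV[K]_n, a \notin moore_zeros K q n & moore_phi q a = b
    & forall a a' : 'rV[K]_n,
        a \notin moore_zeros K q n -> a' \notin moore_zeros K q n ->
        (moore_phi q a = moore_phi q a' <->
         exists2 lambda : K,
           lambda ^+ (\sum_(i < n.-1) q ^ i)%N = 1 & a' = lambda *: a)].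
Proof.
case: n n_ge2 => [|[|m]] // _.
have pcharq : [pchar K].-nat q.
  by rewrite qE pnatX pnatE ?(pcharf_prime charK) ?charK.
split=> [a|b|a a'].
- exact: moore_phi_notin_zeros.
- exact: moore_phi_surj.
- exact: eq_moore_phi.
Qed.
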